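(* Let $p_1,\dots,p_n$ be primes with $p_i\ne 2$ for all $i$, let $\alpha_1,\dots,\alpha_n$ be positive integers, and let $N=2p_1^{\alpha_1}p_2^{\alpha_2}\cdots p_n^{\alpha_n}$. Let $q_1,\dots,q_K$ be all the positive divisors of $N$, and for $i\in\{1,\dots,K\}$ let $$S_{2,q_i}:=\operatorname{span}\{L_{2k}c_{q_i}:0\le k\le\phi(q_i)-1\}\subset\ell^2(\mathbb Z_N).$$ Then for any $\ell\in\mathbb Z$ and any $i\in\{1,\dots,K\}$, the collection $\{L_{2k}c_{q_i}\}_{k=\ell}^{\ell+\phi(q_i)-1}$ is a basis of $S_{2,q_i}$, and thus $\dim S_{2,q_i}=\phi(q_i)$. Moreover, the system $$\mathcal B_N:=\{L_{2k}c_{q_1}\}_{k=0}^{\phi(q_1)-1}\cup\{L_{2k}c_{q_2}\}_{k=0}^{\phi(q_2)-1}\cup\cdots\cup\{L_{2k}c_{q_K}\}_{k=0}^{\phi(q_K)-1}$$ is a basis for $\ell^2(\mathbb Z_N)$, and there is the orthogonal decomposition $$\ell^2(\mathbb Z_N)=S_{2,q_1}\oplus S_{2,q_2}\oplus\cdots\oplus S_{2,q_K}.$$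
   Context: $\ell^2(\mathbb Z_N)$ is the $N$-dimensional complex Hilbert space of functions on $\mathbb Z_N=\{0,1,\dots,N-1\}$ (identified with $N$-periodic functions on $\mathbb Z$), with $\langle x,y\rangle=\sum_{n=0}^{N-1}x(n)\overline{y(n)}$. For $m\in\mathbb Z$, the circular shift is $L_mx(n)=x(n-m)$. For a positive integer $q$, the $q$-th Ramanujan sum is $c_q(n)=\sum_{1\le k\le q,\,(k,q)=1}e^{2\pi i kn/q}$; it is $q$-periodic, so for $q\mid N$ it is regarded as an element of $\ell^2(\mathbb Z_N)$. $\phi$ is Euler's totient function. *)

(* Defs.v *)
From HB Require Import structures.
From mathcomp Require Import all_boot all_order all_algebra.
From mathcomp Require Import complex.
From mathcomp Require Import reals trigo.
Set Implicit Arguments.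
Unset Strict Implicit.
Unset Printing Implicit Defensive.
Import Order.TTheory GRing.Theory Num.Theory.
Local Open Scope ring_scope.
Local Open Scope complex_scope.

(* ['Z_N] is the ring of integers modulo [N] only when [1 < N]. *)
Notation ell2 R N := {ffun 'Z_N -> R[i]^o}.

Definition inner (R : realType) (N : nat) (x y : ell2 R N) : R[i] :=
  \sum_(n : 'Z_N) x n * Num.conj (y n).

Definition shift (R : realType) (N : nat) (m : int) (x : ell2 R N) : ell2 R N :=
  [ffun n : 'Z_N => x (n - m%:~R)].

(* e^(i t), by Euler's formula. *)
Definition expi (R : realType) (t : R) : R[i] := cos t +i* sin t.

Definition ramanujan_sum (R : realType) (q : nat) (n : int) : R[i] :=
  \sum_(1 <= k < q.+1 | coprime k q)
    expi (2 * pi * k%:R * n%:~R / q%:R : R).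

(* The sampling at the representatives 0, ..., N-1 is the [q]-periodic function
   [ramanujan_sum R q] seen on Z_N only when [q] divides [N]. *)
Definition ramanujan_vec (R : realType) (N q : nat) : ell2 R N :=
  [ffun n : 'Z_N => ramanujan_sum R q (n : nat)%:Z].

(* A list rather than a set, so that [free] and [basis_of] count repetitions. *)
Definition even_shifts (R : realType) (N q : nat) (l : int) : seq (ell2 R N) :=
  [seq shift (2 * (l + k%:Z)) (ramanujan_vec R N q) | k <- iota 0 (totient q)].

Definition S2 (R : realType) (N q : nat) : {vspace ell2 R N} :=
  <<even_shifts R N q 0>>%VS.

(* Main.v *)
(* The Ramanujan sum c_q is the sum of the characters of Z_N whose frequency is a
   reduced fraction k / q, and shifting multiplies each character by a scalar.
   Doubling is injective on the residues coprime to q because 4 does not divide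
   N, so these scalars are distinct for the shift by 2; by a Vandermonde
   argument any totient q consecutive even shifts of c_q are independent, and
   they span the same space as the characters. Characters with different
   reduced denominators are orthogonal, and the dimensions totient q add up to
   N over the divisors q of N. *)

Require Import Defs.
From HB Require Import structures.
From mathcomp Require Import all_boot all_order all_algebra.
From mathcomp Require Import complex.
From mathcomp Require Import reals trigo.
From mathcomp Require Import cyclic zify.
Set Implicit Arguments.
Unset Strict Implicit.
Unset Printing Implicit Defensive.
Import Order.TTheory GRing.Theory Num.Theory.
Local Open Scope ring_scope.
Local Open Scope complex_scope.

(** * Complex exponentials and Ramanujan sums *)

Lemma expiD (R : realType) (s t : R) : expi (s + t) = expi s * expi t.
Proof.
apply/eqP; rewrite /expi cosD sinD eq_complex /=.
by rewrite eqxx addrC eqxx.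
Qed.

Lemma expiMn (R : realType) (t : R) (n : nat) : expi (t *+ n) = expi t ^+ n.
Proof.
elim: n => [|n IHn]; first by rewrite /expi cos0 sin0.
by rewrite mulrS expiD IHn exprS.
Qed.

(** If [cos t = 1], the double-angle formula gives [cos (t / 2) ^ 2 = 1], so [sin (t / 2) = 0],
    although [t / 2] lies strictly between 0 and [pi]. *)
Lemma expi_neq1 (R : realType) (t : R) : 0 < t < 2 * pi -> expi t != 1.
Proof.
move=> /andP[t0 t2]; apply/eqP => -[+ _].
have n20 : 2 != 0 :> R by rewrite pnatr_eq0.
rewrite -[t](divfK n20) mulr_natr cos_mulr2n => /(canRL (subrK _)).
rewrite -mulr2n => /eqP; rewrite eqr_pMn2r // => /eqP cos1.
have := cos2Dsin2 (t / 2); rewrite cos1 => /(canRL (addKr _)) /eqP.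
rewrite addNr sqrf_eq0 gt_eqF // sin_gt0_pi // divr_gt0 //=.
by rewrite ltr_pdivrMr // mulrC.
Qed.

Definition zeta (R : realType) (q : nat) : R[i] := expi (2 * pi / q%:R).

Lemma ramanujan_sumE (R : realType) (q n : nat) :
  ramanujan_sum R q n%:Z =
  \sum_(1 <= k < q.+1 | coprime k q) (zeta R q ^+ k) ^+ n.
Proof.
apply: eq_bigr => k _; rewrite -exprM -expiMn; congr expi.
by rewrite -[RHS]mulr_natr natrM -pmulrn -[RHS]mulrA [_^-1 * _]mulrC !mulrA.
Qed.

Definition coprime_residues (q : nat) : seq nat :=
  [seq k <- index_iota 1 q.+1 | coprime k q].

(** [totient] counts over 0, ..., q - 1 instead of 1, ..., q; the exchanged endpoints 0 and q have
    the same gcd with q. *)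
Lemma size_coprime_residues (q : nat) :
  (0 < q)%N -> size (coprime_residues q) = totient q.
Proof.
move=> q0; rewrite size_filter -sum1_count big_mkcond.
rewrite totient_count_coprime big_nat_recr //= [RHS]big_ltn // addnC.
rewrite /coprime gcdnn gcdn0; congr (_ + _)%N.
by apply: eq_bigr => k _; rewrite gcdnC; case: (_ == _).
Qed.

(** * Characters of Z_N and the inner product *)

Definition unit_char (R : realType) (N : nat) (u : R[i]) : ell2 R N :=
  [ffun n : 'Z_N => u ^+ n].

Section Characters.
Variables (R : realType) (N : nat).
Hypothesis N1 : (1 < N)%N.

(** Addition in ['Z_N] reduces exponents modulo [N], which is harmless for an [N]-th root of unity;
    for such [u], [unit_char N u] is a character. *)
Lemma exprZpD (u : R[i]) (x y : 'Z_N) :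
  u ^+ N = 1 -> u ^+ (x + y)%R = u ^+ x * u ^+ y.
Proof.
by move=> uN; rewrite /= [X in (_ %% X)%N](Zp_cast N1) expr_mod // exprD.
Qed.

Lemma root1_neq0 (u : R[i]) : u ^+ N = 1 -> u != 0.
Proof.
move=> uN; apply: contra_eq_neq uN => ->.
by rewrite expr0n gtn_eqF ?(ltnW N1) // eq_sym oner_eq0.
Qed.

Lemma exprZpN (u : R[i]) (x : 'Z_N) :
  u ^+ N = 1 -> u ^+ (- x)%R = (u ^+ x)^-1.
Proof.
move=> uN; have ux0 : u ^+ x != 0 by rewrite expf_neq0 // root1_neq0.
by apply: (mulfI ux0); rewrite -exprZpD // subrr divff.
Qed.

Lemma exprZp_int (u : R[i]) (m : int) :
  u ^+ N = 1 -> u ^+ (m%:~R : 'Z_N) = u ^ m.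
Proof.
move=> uN.
have nat_case (k : nat) : u ^+ (k%:R : 'Z_N) = u ^+ k.
  by rewrite (val_Zp_nat N1) expr_mod.
by case: m => k; rewrite ?NegzE ?mulrNz ?exprZpN // ?pmulrn nat_case // -exprnN.
Qed.

Lemma shift_unit_char (u : R[i]) (m : int) :
  u ^+ N = 1 -> shift m (unit_char N u) = u ^ (- m) *: unit_char N u.
Proof.
move=> uN; apply/ffunP => x; rewrite !ffunE exprZpD // -mulrNz exprZp_int //.
by rewrite mulrC.
Qed.

Lemma inner_suml (I : Type) (r : seq I) (c : I -> R[i]) (F : I -> ell2 R N) y :
  inner (\sum_(i <- r) c i *: F i) y = \sum_(i <- r) c i * inner (F i) y.
Proof.
under [RHS]eq_bigr do rewrite mulr_sumr.
rewrite exchange_big; apply: eq_bigr => n _ /=; rewrite sum_ffunE mulr_suml.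
by apply: eq_bigr => i _; rewrite !ffunE mulrA.
Qed.

Lemma inner_conj (x y : ell2 R N) : inner y x = Num.conj (inner x y).
Proof.
by rewrite rmorph_sum; apply: eq_bigr => n _; rewrite rmorphM /= conjCK mulrC.
Qed.

Lemma inner_eq0 (x : ell2 R N) : inner x x = 0 -> x = 0.
Proof.
move=> /eqP; rewrite psumr_eq0 => [/allP x0|n _]; last exact: mul_conjC_ge0.
by apply/ffunP => n; apply/eqP; rewrite ffunE -mul_conjC_eq0; apply: x0; rewrite mem_index_enum.
Qed.

(** Linearity in the first argument handles one span; conjugate symmetry carries this over to the
    other. *)
Lemma inner_span (X Y : seq (ell2 R N)) :
    {in X & Y, forall x y, inner x y = 0} ->
  {in <<X>>%VS & <<Y>>%VS, forall x y, inner x y = 0}.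
Proof.
have spanl (Z : seq (ell2 R N)) w :
    {in Z, forall z, inner z w = 0} -> {in <<Z>>%VS, forall z, inner z w = 0}.
  move=> Z0 z zZ; rewrite (@coord_span _ _ _ (in_tuple Z) _ zZ) inner_suml big1 // => i _.
  by rewrite Z0 ?mulr0 // mem_nth.
move=> XY0 x y xX yY; apply: (spanl _ _ _ _ xX) => {xX}x xX.
rewrite inner_conj (spanl Y) ?rmorph0 // => {yY}y yY.
by rewrite inner_conj XY0 ?rmorph0.
Qed.

(** Since [v] has modulus 1, its conjugate is its inverse, and the inner product is a geometric sum
    in the [N]-th root of unity [u / v]. *)
Lemma inner_unit_char (u v : R[i]) : u ^+ N = 1 -> v ^+ N = 1 ->
  inner (unit_char N u) (unit_char N v) = (if u == v then N%:R else 0).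
Proof.
move=> uN vN.
have v0 := root1_neq0 vN.
have vE : Num.conj v = v^-1.
  apply: (mulfI v0); rewrite divff // -normCK.
  suff -> : `|v| = 1 by rewrite expr1n.
  by apply/eqP; rewrite -(pexpr_eq1 (ltnW N1)) // -normrX vN normr1.
have -> : inner (unit_char N u) (unit_char N v) = \sum_(i < N) (u / v) ^+ i.
  rewrite -[in RHS](Zp_cast N1); apply: eq_bigr => i _.
  by rewrite !ffunE rmorphXn /= vE expr_div_n exprVn.
case: eqVneq => [->|uv].
  by under eq_bigr do rewrite divff // expr1n; rewrite sumr_const card_ord.
apply/eqP; have /eqP := subrX1 (u / v) N.
rewrite expr_div_n uN vN divr1 subrr eq_sym mulf_eq0 subr_eq0.
by rewrite (can2_eq (divfK v0) (mulfK v0)) mul1r (negPf uv).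
Qed.

(** Pairing a vanishing sum with its [i]-th term leaves only the squared norm of that term. *)
Lemma orthogonal_directv (I : finType) (Us : I -> {vspace ell2 R N}) :
    (forall i j, i != j -> {in Us i & Us j, forall x y, inner x y = 0}) ->
  directv (\sum_i Us i).
Proof.
move=> orthU; apply/directv_sum_independent => us Uus us0 i _.
apply: inner_eq0; have : inner (\sum_j us j) (us i) = 0.
  by rewrite us0 /inner big1 // => n _; rewrite ffunE mul0r.
under eq_bigr do rewrite -[us _]scale1r.
rewrite inner_suml (bigD1 i) //= mul1r big1 ?addr0 // => j ji.
by rewrite mul1r (orthU j i) // Uus.
Qed.

(** * Primitive roots of unity *)

Lemma zeta_prim (q : nat) : (0 < q)%N -> q.-primitive_root (zeta R q).
Proof.
move=> q0; have qR0 : 0 < q%:R :> R by rewrite ltr0n.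
have pi2 : 0 < 2 * pi :> R by rewrite mulr_gt0 ?pi_gt0.
apply/andP; split=> //; apply/forallP => i; rewrite unity_rootE -expiMn.
have [->|iq] := eqVneq i.+1 q.
  rewrite -[X in expi X]mulr_natr divfK ?lt0r_neq0 // mulr_natl /expi cos2pi sin2pi.
  by rewrite !eqxx.
rewrite (negPf (expi_neq1 _)) // pmulrn_lgt0 // divr_gt0 //=.
rewrite -[X in X < _]mulr_natr -mulrA gtr_pMr // mulrC ltr_pdivrMr // mul1r ltr_nat.
by rewrite ltn_neqAle iq ltn_ord.
Qed.

(** The common value is a primitive root both of order [q] and of order [r]. *)
Lemma zeta_coprime_inj (q r a b : nat) : (0 < q)%N -> (0 < r)%N ->
  coprime a q -> coprime b r -> zeta R q ^+ a = zeta R r ^+ b -> q = r.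
Proof.
move=> q0 r0 aq br zab.
have zq : q.-primitive_root (zeta R q ^+ a).
  by rewrite prim_root_exp_coprime // zeta_prim.
have zr : r.-primitive_root (zeta R q ^+ a).
  by rewrite zab prim_root_exp_coprime // zeta_prim.
apply/eqP; rewrite eqn_dvd (prim_order_dvd zq) (prim_order_dvd zr).
by rewrite (prim_expr_order zq) (prim_expr_order zr) eqxx.
Qed.

(** * Shifts of the Ramanujan sum for a fixed divisor of [N] *)

Section Divisor.
Variable q : nat.
Hypothesis qN : (q %| N)%N.

Let q0 : (0 < q)%N. Proof. exact: dvdn_gt0 (ltnW N1) qN. Qed.

Lemma zetaX_root (k : nat) : (zeta R q ^+ k) ^+ N = 1.
Proof.
apply/eqP; rewrite -exprM -(prim_order_dvd (zeta_prim q0)).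
exact: dvdn_mull.
Qed.

Lemma shift_ramanujan_vec (m : int) :
  shift m (ramanujan_vec R N q) =
  \sum_(k <- coprime_residues q)
    (zeta R q ^+ k) ^ (- m) *: unit_char N (zeta R q ^+ k).
Proof.
apply/ffunP => n; rewrite !ffunE ramanujan_sumE big_filter sum_ffunE.
apply: eq_bigr => k _; rewrite -(shift_unit_char _ (zetaX_root k)).
by rewrite !ffunE.
Qed.

Lemma mem_coprime_residues (k : nat) :
  (k \in coprime_residues q) = [&& coprime k q, (0 < k)%N & (k <= q)%N].
Proof. by rewrite mem_filter mem_index_iota ltnS. Qed.

Lemma coprime_residues_uniq : uniq (coprime_residues q).
Proof. exact/filter_uniq/iota_uniq. Qed.

Lemma zeta_residue_inj :
  {in coprime_residues q &, injective (fun k => zeta R q ^+ k)}.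
Proof.
move=> a b; rewrite !mem_coprime_residues => /and3P[_ a0 aq] /and3P[_ b0 bq].
move=> /eqP; rewrite (eq_prim_root_expr (zeta_prim q0)).
wlog ab : a b a0 aq b0 bq / (a <= b)%N => [wl|].
  by case/orP: (leq_total a b) => ?; last rewrite eq_sym; move=> /wl ->.
rewrite eq_sym eqn_mod_dvd // => qba.
apply/eqP; rewrite eqn_leq ab leqNgt -subn_gt0; apply/negP => ba0.
(* Both residues lie in 1, ..., q, so their difference is less than [q]. *)
by have := dvdn_leq ba0 qba; lia.
Qed.

(** Orthogonality isolates one coefficient of the expansion into characters. *)
Lemma inner_shift_ramanujan (m : int) (k : nat) : k \in coprime_residues q ->
  inner (shift m (ramanujan_vec R N q)) (unit_char N (zeta R q ^+ k)) =
  (zeta R q ^+ k) ^ (- m) * N%:R.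
Proof.
move=> kq; rewrite shift_ramanujan_vec inner_suml.
rewrite (bigD1_seq k) ?coprime_residues_uniq //= big_seq_cond.
rewrite big1 ?addr0 => [|j /andP[jq jk]].
  by rewrite inner_unit_char ?zetaX_root // eqxx.
rewrite inner_unit_char ?zetaX_root // ifN ?mulr0 //.
by apply: contra_neq jk => /zeta_residue_inj ->.
Qed.

Section NotMod4.
Hypothesis q4 : ~~ (4 %| q)%N.

(* For even q the residues are odd, so two of them agree mod q as soon as they
   agree mod the odd number q / 2. *)
Lemma double_residue_inj (a b : nat) :
  a \in coprime_residues q -> b \in coprime_residues q ->
  (2 * a == 2 * b %[mod q])%N -> a = b.
Proof.
rewrite !mem_coprime_residues.
wlog ab : a b / (a <= b)%N => [wl aq bq|].
  by case/orP: (leq_total a b) => ?; last rewrite eq_sym; move=> /wl ->.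
case/and3P=> aq a0 leaq /and3P[bq b0 lebq].
rewrite eq_sym eqn_mod_dvd ?leq_mul2l // -mulnBr => q2ba.
apply/eqP; rewrite eqn_leq ab leqNgt -subn_gt0; apply/negP => ba0.
suff /(dvdn_leq ba0) : (q %| b - a)%N by lia.
case: (boolP (odd q)) => qodd; first by rewrite Gauss_dvdr // coprimen2 in q2ba.
have q2 : (2 %| q)%N by rewrite dvdn2.
case/dvdnP: (q2) => r qE.
have rodd : odd r.
  by move: q4; rewrite qE -[4%N]/(2 * 2)%N dvdn_pmul2r // dvdn2 negbK.
move: q2ba; rewrite qE mulnC dvdn_pmul2l // => rba.
rewrite Gauss_dvd ?coprime2n // rba dvdn2 oddB //.
have := (coprime_dvdr q2 aq, coprime_dvdr q2 bq).
by rewrite !coprimen2 => -[-> ->].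
Qed.

(* A linear relation with coefficients c among the shifts, paired with the
   character of frequency k / q, says that the polynomial with coefficients c
   vanishes at e^(-4 i pi k / q): this gives totient q distinct roots for a
   polynomial of degree less than totient q. *)
Lemma even_shifts_free (l : int) : free (even_shifts R N q l).
Proof.
pose X := in_tuple (even_shifts R N q l).
apply/(@freeP _ _ _ X) => c cX0.
have sX : size (even_shifts R N q l) = totient q by rewrite size_map size_iota.
pose P := rVpoly (\row_i c i).
have sP : (size P <= size (even_shifts R N q l))%N by exact: size_poly.
suff P0 : P = 0.
  move=> i; have := coef_rVpoly_ord (\row_i c i) i.
  by rewrite -/P P0 coef0 mxE.
pose z k := (zeta R q ^+ k) ^ (- 2).
have zeta0 k : zeta R q ^+ k != 0 by exact: root1_neq0 (zetaX_root k).
apply/eqP/negPn/negP => P0.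
have rootP : all (root P) (map z (coprime_residues q)).
  apply/allP => _ /mapP[k kq ->].
  have : inner (\sum_i c i *: X`_i) (unit_char N (zeta R q ^+ k)) = 0.
    by rewrite cX0 /inner big1 // => n _; rewrite ffunE mul0r.
  (* The [i]-th shift pairs to [z k ^ (l + i) * N%:R]; the factor common to all [i] is nonzero and
     cancels, so any starting index [l] works. *)
  have zl0 : z k ^ l * N%:R != 0.
    by rewrite mulf_neq0 ?expfz_neq0 ?pnatr_eq0 -?lt0n ?(ltnW N1) // expfz_neq0.
  rewrite inner_suml => sum0; rewrite /root (horner_coef_wide _ sP).
  apply/eqP/(mulIf zl0); rewrite mul0r mulr_suml -[RHS]sum0.
 apply: eq_bigr => i _.
  rewrite coef_rVpoly_ord mxE (nth_map 0%N) ?size_iota -?sX // nth_iota -?sX //.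
  rewrite inner_shift_ramanujan // add0n -!mulrA; congr (_ * _).
  rewrite mulrA; congr (_ * _); rewrite /z -mulNr -exprz_exp -/(z k).
  by rewrite expfzDr ?expfz_neq0 // mulrC.
(* By primitivity, [z a = z b] means that [2 * a] and [2 * b] agree modulo [q]. *)
have uniqz : uniq (map z (coprime_residues q)).
  rewrite map_inj_in_uniq ?coprime_residues_uniq // => a b aq bq.
  rewrite /z -!exprnN => /invr_inj; rewrite -!exprM => /eqP.
  rewrite (eq_prim_root_expr (zeta_prim q0)) ![(_ * 2)%N]mulnC.
  exact: double_residue_inj.
have := max_poly_roots P0 rootP uniqz.
by rewrite size_map size_coprime_residues // ltnNge -sX sP.
Qed.

(** One inclusion is the expansion into characters; equality follows because [totient q] independent
    vectors lie in a span of [totient q] generators. The right side does not depend on [l]. *)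
Lemma even_shifts_span (l : int) :
  <<even_shifts R N q l>>%VS =
  <<[seq unit_char N (zeta R q ^+ k) | k <- coprime_residues q]>>%VS.
Proof.
apply/eqP; rewrite eqEdim; apply/andP; split.
  apply/span_subvP => _ /mapP[j _ ->]; rewrite shift_ramanujan_vec big_seq.
  apply: memv_suml => k kq; apply/memvZ/memv_span.
  by rewrite (map_f (fun k => unit_char N (zeta R q ^+ k))).
rewrite (eqP (even_shifts_free l)) size_map size_iota.
by rewrite (leq_trans (dim_span _)) // size_map size_coprime_residues.
Qed.

Lemma even_shifts_basis (l : int) :
  basis_of (S2 R N q) (even_shifts R N q l).
Proof.
rewrite /basis_of /S2 (even_shifts_span l) (even_shifts_span 0) eqxx.
exact: even_shifts_free.
Qed.

Lemma dim_S2 : \dim (S2 R N q) = totient q.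
Proof. by rewrite /S2 (eqP (even_shifts_free 0)) size_map size_iota. Qed.

End NotMod4.
End Divisor.

(** It suffices to compare the spanning characters, and a character common to both families would
    force [q = r]. *)
Lemma S2_orthogonal (q r : nat) :
    (q %| N)%N -> (r %| N)%N -> ~~ (4 %| q)%N -> ~~ (4 %| r)%N -> q != r ->
  {in S2 R N q & S2 R N r, forall x y, inner x y = 0}.
Proof.
move=> qN rN q4 r4 qr; rewrite /S2 !even_shifts_span //.
apply: inner_span => _ _ /mapP[a aq ->] /mapP[b br ->].
rewrite inner_unit_char ?zetaX_root //; case: eqP => // zab; case/eqP: qr.
move: aq br; rewrite !mem_coprime_residues => /and3P[aq _ _] /and3P[br _ _].
by apply: zeta_coprime_inj zab => //; apply: dvdn_gt0 (ltnW N1) _.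
Qed.

End Characters.

(** * Dimension count and assembly over all divisors *)

Lemma sum_totient_divisors (N : nat) :
  (0 < N)%N -> (\sum_(d <- divisors N) totient d = N)%N.
Proof.
move=> N0; rewrite -[RHS]sum_totient_dvd.
rewrite -(big_mkord (fun d => d %| N)%N totient) -[RHS]big_filter; apply: perm_big.
apply: uniq_perm; rewrite ?divisors_uniq ?filter_uniq ?iota_uniq // => d.
rewrite mem_filter mem_index_iota -dvdn_divisors //= ltnS.
by case: (boolP (d %| N)%N) => // /(dvdn_leq N0) ->.
Qed.

Lemma flatten_map_enum (I : finType) (T : Type) (F : I -> seq T) :
  flatten [seq F i | i <- enum I] = \big[cat/[::]]_i F i.
Proof.
rewrite [index_enum I]unlock enumT.
by elim: (Finite.enum I) => [|i s IHs]; rewrite ?big_nil // big_cons /= IHs.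
Qed.

Local Close Scope complex_scope.

Theorem theorem2p14 (R : realType) (n : nat) (p alpha : 'I_n -> nat)
    (hp : forall i, prime (p i)) (hp2 : forall i, p i <> 2%N)
    (halpha : forall i, (0 < alpha i)%N)
    (N : nat) (hN : N = (2 * \prod_(i < n) p i ^ alpha i)%N)
    (K : nat) (q : K.-tuple nat) (hq : perm_eq q (divisors N)) :
  (forall (l : int) (i : 'I_K),
      basis_of (S2 R N (tnth q i)) (even_shifts R N (tnth q i) l)) /\
  (forall i : 'I_K, \dim (S2 R N (tnth q i)) = totient (tnth q i)) /\
  basis_of (fullv : {vspace ell2 R N})
    (flatten [seq even_shifts R N (tnth q i) 0 | i <- enum 'I_K]) /\
  ((\sum_(i < K) S2 R N (tnth q i))%VS = fullv /\
   directv (\sum_(i < K) S2 R N (tnth q i))%VS /\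
   (forall i j : 'I_K, i != j ->
      forall x y : ell2 R N,
        x \in S2 R N (tnth q i) -> y \in S2 R N (tnth q j) -> inner x y = 0)).
Proof.
have Modd : odd (\prod_(i < n) p i ^ alpha i)%N.
  apply: (big_ind (fun m => odd m)) => // [x y xo yo|i _]; first by rewrite oddM xo.
  by rewrite oddX; case: (even_prime (hp i)) => [/hp2 //|->]; rewrite orbT.
(* Oddness rules out a zero product; the empty product gives [N = 2]. *)
have N1 : (1 < N)%N.
  by rewrite hN mul2n; case: (\prod_(i < n) _)%N Modd.
have qN i : (tnth q i %| N)%N.
  by rewrite dvdn_divisors ?(ltnW N1) // -(perm_mem hq) mem_tnth.
have q4 i : ~~ (4 %| tnth q i)%N.
  apply: contraL Modd => q4; have := dvdn_trans q4 (qN i).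
  by rewrite hN -[4%N]/(2 * 2)%N dvdn_pmul2l // dvdn2.
have /tuple_uniqP q_inj : uniq q by rewrite (perm_uniq hq) divisors_uniq.
have orthS (i j : 'I_K) : i != j -> forall x y : ell2 R N,
    x \in S2 R N (tnth q i) -> y \in S2 R N (tnth q j) -> inner x y = 0.
  move=> ij x y; apply: S2_orthogonal => //.
  by rewrite (inj_eq q_inj).
have dirS : directv (\sum_(i < K) S2 R N (tnth q i))%VS.
  by apply: orthogonal_directv => i j ij x y xi yj; exact: orthS ij _ _ xi yj.
have sumS : (\sum_(i < K) S2 R N (tnth q i))%VS = fullv.
  (* By directness the dimension of the sum is the sum of the totients, which equals [N]. *)
  apply/eqP; rewrite eqEdim subvf (directvP dirS) /= dimvf.
  under eq_bigr do rewrite dim_S2 //.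
  rewrite -(big_tuple _ _ q predT totient) (perm_big _ hq).
  rewrite sum_totient_divisors ?(ltnW N1) //.
  by rewrite /dim /= card_ord Zp_cast // muln1.
split; first by move=> l i; exact: even_shifts_basis.
split; first by move=> i; exact: dim_S2.
split=> //; rewrite flatten_map_enum -sumS.
by apply: bigcat_basis => // i _; exact: even_shifts_basis.
Qed.
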